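(* For integers $m,n\ge1$ let $P_{m,n}(z)=\frac{(m+n)^{m+n}}{m^m n^n}z^m(1-z)^n\in\mathbb{Q}[z]$, and for $e\ge1$ let $\pi_e(w)=w^e$. Let $k=\gcd(m,n)$. Then $$P_{m,n}=\pi_k\circ P_{m/k,\,n/k}$$ as polynomials in $\mathbb{Q}[z]$. More generally, $P_{m,n}=\pi_e\circ P_{m/e,\,n/e}$ for every common divisor $e\geq 1$ of $m$ and $n$. Moreover, $P_{m,n}$ admits no factorization of the form $P_{m,n}=\pi_e\circ Q$ with $e>1$ an integer and $Q\in\mathbb{C}[z]$ a polynomial if and only if $\gcd(m,n)=1$. *)

(* Defs.v *)
From mathcomp Require Import all_boot all_algebra.

Set Implicit Arguments.
Unset Strict Implicit.
Unset Printing Implicit Defensive.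

Import GRing.Theory.
Local Open Scope ring_scope.

Definition P (m n : nat) : {poly rat} :=
  (((m + n) ^ (m + n))%:R / ((m ^ m)%:R * (n ^ n)%:R)) *:
    ('X^m * (1 - 'X) ^+ n).

Definition pi_pow (A : nzRingType) (e : nat) : {poly A} := 'X^e.
Arguments pi_pow {A} e.

(* Main.v *)
(** In the coefficient of [P (a e) (b e)] the powers of [e] in numerator and
    denominator cancel, which leaves the [e]-th power of that of [P a b].
    Conversely, if [P m n = Q^e] then [e] divides the multiplicities [m] of the
    root 0 and [n] of the root 1, hence [gcd(m,n)]. *)

Require Import Defs.
From mathcomp Require Import all_boot all_algebra.
From mathcomp Require Import reals complex.

Set Implicit Arguments.
Unset Strict Implicit.
Unset Printing Implicit Defensive.

Import GRing.Theory.
Local Open Scope ring_scope.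

(** The reciprocal of the maximum of [z^m (1 - z)^n] on [0, 1], attained at [z = m / (m + n)]. *)
Definition Pcoef (m n : nat) : rat :=
  ((m + n) ^ (m + n))%:R / ((m ^ m)%:R * (n ^ n)%:R).

(** The case [n = 0] rests on the convention [0 ^ 0 = 1]. *)
Lemma natr_self_exp_neq0 (n : nat) : (n ^ n)%:R != 0 :> rat.
Proof. by rewrite Num.Theory.pnatr_eq0 expn_eq0; case: n. Qed.

Lemma Pcoef_neq0 (m n : nat) : Pcoef m n != 0.
Proof. by rewrite mulf_neq0 ?invr_eq0 ?mulf_neq0 ?natr_self_exp_neq0. Qed.

Lemma PcoefMM (e a b : nat) :
  (0 < e)%N -> Pcoef (a * e) (b * e) = Pcoef a b ^+ e.
Proof.
move=> e_gt0.
have self_expM d :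
    ((d * e) ^ (d * e))%:R = (d ^ d)%:R ^+ e * e%:R ^+ (d * e) :> rat.
  by rewrite expnMn expnM natrM !natrX.
have e_neq0 i : e%:R ^+ i != 0 :> rat.
  by rewrite expf_neq0 // Num.Theory.pnatr_eq0 -lt0n.
(* Both numerator and denominator acquire the factor [e%:R ^+ (a * e + b * e)]; it is split off as a
   quotient equal to 1. *)
rewrite /Pcoef -mulnDl !self_expM mulrACA -exprMn mulnDl -exprD.
by rewrite -mulf_div divff ?mulr1 ?expr_div_n.
Qed.

Lemma P_MM (e a b : nat) :
  (0 < e)%N -> P (a * e) (b * e) = pi_pow e \Po P a b.
Proof.
move=> e_gt0; rewrite /pi_pow comp_Xn_poly /P -!/(Pcoef _ _) PcoefMM //.
by rewrite exprZn; congr (_ *: _); rewrite exprMn -!exprM.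
Qed.

Lemma P_dvd (e m n : nat) : (0 < e)%N -> (e %| m)%N -> (e %| n)%N ->
  P m n = pi_pow e \Po P (m %/ e) (n %/ e).
Proof. by move=> e_gt0 em en; rewrite -P_MM // !divnK. Qed.

Lemma mup_exp (F : fieldType) (x : F) (q : {poly F}) (e : nat) :
  q != 0 -> mup x (q ^+ e) = (e * mup x q)%N.
Proof.
move=> q_neq0; elim: e => [|e IHe]; first by rewrite expr0 mupNroot ?root1.
by rewrite exprS mupM ?expf_neq0 // IHe mulSn.
Qed.

Lemma mupZ (F : fieldType) (x c : F) (q : {poly F}) :
  c != 0 -> mup x (c *: q) = mup x q.
Proof. by move=> c_neq0; rewrite -mul_polyC mupMr // rootC. Qed.

(** Exhibits the monic linear factor at the root 1, whose powers have known multiplicities. *)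
Lemma subr1X (A : nzRingType) : 1 - 'X = -1 *: ('X - 1%:P) :> {poly A}.
Proof. by rewrite scaleN1r opprB polyC1. Qed.

(** The cofactor [(1 - 'X) ^+ n] takes the value 1 at 0, so only ['X^m] contributes; at the root 1
    the roles are exchanged. *)
Lemma mup0_X1X (F : fieldType) (c : F) (m n : nat) :
  c != 0 -> mup 0 (c *: ('X^m * (1 - 'X) ^+ n)) = m.
Proof.
move=> c_neq0; rewrite mupZ // mupMl.
  by rewrite -['X]subr0 -polyC0 mup_XsubCX eqxx.
by rewrite /root horner_exp !hornerE subr0 expr1n oner_neq0.
Qed.

Lemma mup1_X1X (F : fieldType) (c : F) (m n : nat) :
  c != 0 -> mup 1 (c *: ('X^m * (1 - 'X) ^+ n)) = n.
Proof.
move=> c_neq0; rewrite mupZ // mupMr; last first.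
  by rewrite /root hornerXn expr1n oner_neq0.
by rewrite subr1X exprZn mupZ ?signr_eq0 // mup_XsubCX eqxx.
Qed.

Lemma dvdn_gcd_X1X_eq_exp (F : fieldType) (c : F) (m n e : nat) (Q : {poly F}) :
  c != 0 -> c *: ('X^m * (1 - 'X) ^+ n) = Q ^+ e -> (e %| gcdn m n)%N.
Proof.
move=> c_neq0 eqQ.
have mult_m := mup0_X1X m n c_neq0; have mult_n := mup1_X1X m n c_neq0.
have Qe_neq0 : Q ^+ e != 0.
  rewrite -eqQ subr1X scaler_eq0 mulf_eq0 negb_or c_neq0 negb_or.
  rewrite monic_neq0 ?monicXn // expf_neq0 //.
  by rewrite scaler_eq0 oppr_eq0 oner_eq0 polyXsubC_eq0.
rewrite eqQ in mult_m mult_n.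
(* For [e = 0] the power is the constant 1, which has no roots; this forces [m = n = 0], and 0
   divides [gcdn 0 0 = 0]. *)
case: e => [|e] in eqQ mult_m mult_n Qe_neq0 *.
  by rewrite expr0 !mupNroot ?root1 // in mult_m mult_n;
    rewrite -mult_m -mult_n.
move: Qe_neq0; rewrite expf_eq0 /= => Q_neq0.
by rewrite dvdn_gcd -mult_m -mult_n !mup_exp // !dvdn_mulr.
Qed.

(** Extending scalars keeps the shape needed to read off multiplicities over the complex numbers. *)
Lemma map_P (F : numFieldType) (m n : nat) :
  map_poly ratr (P m n) =
    ratr (Pcoef m n) *: ('X^m * (1 - 'X) ^+ n) :> {poly F}.
Proof.
rewrite map_polyZ; congr (_ *: _).
by rewrite rmorphM /= map_polyXn rmorphXn rmorphB /= rmorph1 map_polyX.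
Qed.

Theorem theorem7p4 (R : realType) (m n : nat)
    (hm : (1 <= m)%N) (hn : (1 <= n)%N) :
  let k := gcdn m n in
  [/\ P m n = pi_pow k \Po P (m %/ k)%N (n %/ k)%N,
      forall e : nat, (1 <= e)%N -> (e %| m)%N -> (e %| n)%N ->
        P m n = pi_pow e \Po P (m %/ e)%N (n %/ e)%N
    & ~ (exists (e : nat) (Q : {poly R[i]}),
           (1 < e)%N /\ map_poly ratr (P m n) = pi_pow e \Po Q)
      <-> gcdn m n = 1%N].
Proof.
move=> k.
have k_gt0 : (0 < k)%N by rewrite gcdn_gt0 hm.
have P_k : P m n = pi_pow k \Po P (m %/ k) (n %/ k).
  by rewrite -P_dvd ?dvdn_gcdl ?dvdn_gcdr.
split=> [||]; [exact: P_k | by move=> e; exact: P_dvd |].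
split=> [noQ | gcd1 [e [Q [e_gt1]]]].
  apply/eqP; rewrite eqn_leq k_gt0 andbT leqNgt; apply/negP => k_gt1.
  (* The forbidden factorization is [P_k] itself, carried from [rat] to [R[i]]. *)
  apply: noQ; exists k, (map_poly ratr (P (m %/ k) (n %/ k))); split=> //.
  by rewrite {1}P_k map_comp_poly map_polyXn.
rewrite map_P comp_Xn_poly => /dvdn_gcd_X1X_eq_exp.
(* The scalar stays nonzero because [ratr] is injective, so [e] divides the gcd, which is 1. *)
rewrite fmorph_eq0 Pcoef_neq0 gcd1 dvdn1 => /(_ isT) /eqP e1.
by rewrite e1 in e_gt1.
Qed.
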